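(* Let $A,B\in\mathbb{R}^{m\times n}$ be such that $\ker(B)=\{0\}$, and let $B^+$ be the Moore-Penrose inverse of $B$. Then $$B\left(\operatorname*{arg\,max}_{\|Bx\|_2\leq 1}\|Ax\|_2\right)= B\mathbb{R}^n \cap \operatorname*{arg\,max}_{\|y\|_2\leq 1} \left\|AB^+y\right\|_2 = B\mathbb{R}^n \cap \operatorname{suppv}\left(AB^+\right).$$
   Context: $\|\cdot\|_2$ is the Euclidean norm, and $B\mathbb{R}^n=\{Bx:x\in\mathbb{R}^n\}\subseteq\mathbb{R}^m$. The Moore-Penrose inverse of $B\in\mathbb{R}^{m\times n}$ is the unique matrix $B^+\in\mathbb{R}^{n\times m}$ with $BB^+B=B$, $B^+BB^+=B^+$, $(BB^+)^*=BB^+$, $(B^+B)^*=B^+B$. $\operatorname*{arg\,max}_{\|Bx\|_2\leq 1}\|Ax\|_2$ is the set of all $x_0\in\mathbb{R}^n$ with $\|Bx_0\|_2\leq 1$ such that $\|Ax_0\|_2\geq\|Ax\|_2$ for all $x\in\mathbb{R}^n$ with $\|Bx\|_2\leq 1$; similarly $\operatorname*{arg\,max}_{\|y\|_2\leq 1}\|AB^+y\|_2$ is the set of maximizers over the closed Euclidean unit ball of $\mathbb{R}^m$. For a matrix (or continuous linear operator) $R$, the set of supporting vectors is $\operatorname{suppv}(R):=\operatorname*{arg\,max}_{\|y\|\leq 1}\|Ry\|$ (here with the Euclidean norms). *)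

(* Defs.v *)
From HB Require Import structures.
From mathcomp Require Import all_boot all_order all_algebra.
From mathcomp Require Import boolp classical_sets reals.

Set Implicit Arguments.
Unset Strict Implicit.
Unset Printing Implicit Defensive.

Import Order.TTheory GRing.Theory Num.Theory.

Local Open Scope classical_set_scope.
Local Open Scope ring_scope.

(* The norm `|x| that MathComp-Analysis puts on matrices is the max norm, hence
   a separate definition. *)
Definition norm2 (R : realType) (n : nat) (x : 'cV[R]_n) : R :=
  Num.sqrt (\sum_(i < n) x i 0 ^+ 2).

Definition argmax (R : realType) (T : Type) (D : set T) (f : T -> R) : set T :=
  [set x0 | D x0 /\ forall x, D x -> f x <= f x0].

Definition suppv (R : realType) (m n : nat) (S : 'M[R]_(m, n)) : set 'cV[R]_n :=
  argmax [set y | norm2 y <= 1] (fun y => norm2 (S *m y)).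

Definition is_moore_penrose (R : realType) (m n : nat)
    (B : 'M[R]_(m, n)) (X : 'M[R]_(n, m)) : Prop :=
  [/\ B *m X *m B = B, X *m B *m X = X,
      (B *m X)^T = B *m X & (X *m B)^T = X *m B].

(* The default value 0 is never used, by moore_penroseP below. *)
Definition moore_penrose (R : realType) (m n : nat)
    (B : 'M[R]_(m, n)) : 'M[R]_(n, m) :=
  xget 0 [set X | is_moore_penrose B X].

Lemma is_moore_penrose_unique (R : realType) (m n : nat)
    (B : 'M[R]_(m, n)) (X Y : 'M[R]_(n, m)) :
  is_moore_penrose B X -> is_moore_penrose B Y -> X = Y.
Proof.
move=> [BXB XBX BX XB] [BYB YBY BY YB].
have eB : B *m X = B *m Y.
  by rewrite -{1}BYB -mulmxA -BX -BY -trmx_mul mulmxA BXB BY.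
have eX : X *m B = Y *m B.
  by rewrite -{1}BYB -mulmxA mulmxA -XB -YB -trmx_mul -mulmxA (mulmxA B) BXB YB.
by rewrite -XBX eX -mulmxA eB mulmxA YBY.
Qed.

Lemma gram_unit (R : realType) (r n : nat) (F : 'M[R]_(r, n)) :
  row_free F -> F *m F^T \in unitmx.
Proof.
move=> Ffree; rewrite -row_free_unit -kermx_eq0; apply/eqP/row_matrixP => i.
rewrite row0; set v := row i _.
have vFF : v *m (F *m F^T) = 0 by rewrite /v -row_mul mulmx_ker row0.
have vF : v *m F = 0.
  have : (v *m F) *m (v *m F)^T = 0 by rewrite trmx_mul !mulmxA -(mulmxA v) vFF mul0mx.
  move/matrixP => /(_ 0 0); rewrite !mxE => /eqP.
  rewrite psumr_eq0; last by move=> j _; rewrite [in X in _ * X]mxE -expr2 sqr_ge0.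
  move=> /allP h; apply/rowP => j; have := h j (mem_index_enum j).
  by rewrite [in X in _ * X]mxE -expr2 sqrf_eq0 => /eqP ->; rewrite mxE.
by apply: (row_free_inj Ffree); rewrite vF mul0mx.
Qed.

Lemma moore_penroseP (R : realType) (m n : nat) (B : 'M[R]_(m, n)) :
  is_moore_penrose B (moore_penrose B).
Proof.
have [r [C [F [eB Ffree Cfull]]]] :
    exists r (C : 'M_(m, r)) (F : 'M_(r, n)),
      [/\ B = C *m F, row_free F & row_full C].
  by exists (\rank B), (col_base B), (row_base B); split;
    rewrite ?mulmx_base ?row_base_free ?col_base_full.
have UF := gram_unit Ffree.
have UC : C^T *m C \in unitmx.
  rewrite -[X in _ *m X]trmxK; apply: gram_unit.
  by rewrite /row_free mxrank_tr.
pose F' := F^T *m invmx (F *m F^T); pose C' := invmx (C^T *m C) *m C^T.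
have FF' : F *m F' = 1%:M by rewrite mulmxA mulmxV.
have CC' : C' *m C = 1%:M by rewrite -mulmxA mulVmx.
have BX : B *m (F' *m C') = C *m C' by rewrite eB -mulmxA (mulmxA F) FF' mul1mx.
have XB : F' *m C' *m B = F' *m F by rewrite eB -mulmxA (mulmxA C') CC' mul1mx.
apply: (@xgetPex _ 0 [set X | is_moore_penrose B X]).
exists (F' *m C'); split; rewrite ?BX ?XB.
- by rewrite {1}eB -mulmxA (mulmxA C') CC' mul1mx.
- by rewrite -mulmxA (mulmxA F) FF' mul1mx.
- by rewrite /C' !trmx_mul trmx_inv trmx_mul !trmxK mulmxA.
- by rewrite /F' !trmx_mul trmx_inv trmx_mul !trmxK mulmxA.
Qed.

(* Main.v *)
Require Import Defs.
From HB Require Import structures.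
From mathcomp Require Import all_boot all_order all_algebra.
From mathcomp Require Import boolp classical_sets reals.

Set Implicit Arguments.
Unset Strict Implicit.
Unset Printing Implicit Defensive.

Import Order.TTheory GRing.Theory Num.Theory.

Local Open Scope classical_set_scope.
Local Open Scope ring_scope.

(* Injectivity of [B] makes [B^+] a left inverse of [B], so [A x = A B^+ (B x)].
   As [B B^+] is an orthogonal projection, hence a contraction, every [y] in the
   unit ball gives a feasible [x = B^+ y] with the same objective value. *)

(** Lets Pythagoras below be proved by matrix algebra instead of on sums. *)
Lemma norm2E (R : realType) (n : nat) (x : 'cV[R]_n) :
  norm2 x = Num.sqrt ((x^T *m x) 0 0).
Proof. by rewrite /norm2 mxE; congr Num.sqrt; apply: eq_bigr => i _; rewrite mxE. Qed.

Lemma trmx_mul_self_ge0 (R : realType) (n : nat) (x : 'cV[R]_n) :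
  0 <= (x^T *m x) 0 0.
Proof. by rewrite mxE; apply: sumr_ge0 => i _; rewrite mxE -expr2 sqr_ge0. Qed.

(** Pythagoras: the squared norms of [y] and [P y] differ by that of [y - P y], which is
    nonnegative. *)
Lemma norm2_orthogonal_projection_le (R : realType) (m : nat) (P : 'M[R]_m)
    (y : 'cV[R]_m) :
  P^T = P -> P *m P = P -> norm2 (P *m y) <= norm2 y.
Proof.
move=> PT PP; rewrite !norm2E ler_wsqrtr//.
have Py : (P *m y)^T *m (P *m y) = y^T *m (P *m y).
  by rewrite trmx_mul PT -mulmxA (mulmxA P) PP.
have pyth : y^T *m y - (P *m y)^T *m (P *m y) =
    (y - P *m y)^T *m (y - P *m y).
  (* After expansion, [Py] and the symmetry of [P] turn both cross terms and the last square into
     [y^T P y]; two of the three copies cancel. *)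
  rewrite [(y - P *m y)^T]linearB /= mulmxBl !mulmxBr Py.
  by rewrite (trmx_mul P y) PT -mulmxA subrr subr0.
rewrite -subr_ge0; move/matrixP: pyth => /(_ 0 0).
by rewrite mxE [X in _ + X]mxE => ->; exact: trmx_mul_self_ge0.
Qed.

(** The Penrose equations make [B B^+] symmetric and idempotent. *)
Lemma norm2_moore_penrose_le (R : realType) (m n : nat) (B : 'M[R]_(m, n))
    (y : 'cV[R]_m) :
  norm2 (B *m (moore_penrose B *m y)) <= norm2 y.
Proof.
have [BXB _ BX _] := moore_penroseP B.
rewrite mulmxA; apply: norm2_orthogonal_projection_le => //.
by rewrite mulmxA BXB.
Qed.

Lemma moore_penroseK (R : realType) (m n : nat) (B : 'M[R]_(m, n)) :
  [set x : 'cV[R]_n | B *m x = 0] = [set 0] ->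
  forall x : 'cV[R]_n, moore_penrose B *m (B *m x) = x.
Proof.
move=> kerB x; have [BXB _ _ _] := moore_penroseP B.
apply/eqP; rewrite -subr_eq0; apply/eqP.
(* [B B^+ B = B] puts the difference in the kernel of [B], which is trivial. *)
suff : [set x : 'cV[R]_n | B *m x = 0] (moore_penrose B *m (B *m x) - x).
  by rewrite kerB.
by rewrite /= mulmxBr !mulmxA BXB subrr.
Qed.

Theorem mainTheorem2 (R : realType) (m n : nat) (A B : 'M[R]_(m, n))
    (kerB : [set x : 'cV[R]_n | B *m x = 0] = [set 0]) :
  [set B *m x | x in
     argmax [set x : 'cV[R]_n | norm2 (B *m x) <= 1] (fun x => norm2 (A *m x))]
  = [set B *m x | x in [set: 'cV[R]_n]] `&`
    argmax [set y : 'cV[R]_m | norm2 y <= 1]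
      (fun y => norm2 (A *m moore_penrose B *m y))
  /\
  [set B *m x | x in [set: 'cV[R]_n]] `&`
    argmax [set y : 'cV[R]_m | norm2 y <= 1]
      (fun y => norm2 (A *m moore_penrose B *m y))
  = [set B *m x | x in [set: 'cV[R]_n]] `&` suppv (A *m moore_penrose B).
Proof.
(* The second equality is the definition of [suppv], so [//] closes it. *)
split=> //; have XB := moore_penroseK kerB.
apply/seteqP; split=> [_ [x0 [/= Bx0 max0] <-]|_ [[x0 _ <-] [/= Bx0 max0]]].
  split; first by exists x0.
  split=> //= y y1; rewrite -!mulmxA XB; apply: max0.
  exact: le_trans (norm2_moore_penrose_le B y) y1.
(* Conversely, [B x0] is compared with the points [B x] of the unit ball, where the objective equals
   the norm of [A x]. *)
exists x0 => //; split=> //= x Bx.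
by have := max0 _ Bx; rewrite -!mulmxA !XB.
Qed.
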